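(* Let $\mathrm m\in\mathbb Z^d$ be primitive (components setwise coprime), and let $n=n(\mathrm m)$ be the length of the shortest cycle with index $\mathrm m$ in the fundamental graph $\mathcal G_*$ (assume such a cycle exists). Then $$\mathcal I^{\mathrm m}_{n+1}(Q)=\sum_{\mathbf c\in\mathcal P_n^{\mathrm m}}h_1(q_1,\dots,q_n),$$ $$\mathcal I^{\mathrm m}_{n+2}(Q)=\sum_{\mathbf c\in\mathcal P_n^{\mathrm m}}h_2(q_1,\dots,q_n)+\sum_{\mathbf c\in\mathcal P_{n+1}^{\mathrm m}}h_1(q_1,\dots,q_{n+1}),$$ where in each sum $\mathbf c=[\mathbf e_1,\dots,\mathbf e_\ell]$ runs over distinct prime cycles (as edge sequences), $\mathbf e_j=(v_j,v_{j+1})$, $q_j=Q(v_j)$, and $h_1(x_1,\dots,x_\ell)=\sum_{j}x_j$, $h_2(x_1,\dots,x_\ell)=\sum_{1\le j\le l\le \ell}x_jx_l$. In particular, if the periodic graph $\mathcal G$ is bipartite, then $\mathcal P_{n+1}^{\mathrm m}=\varnothing$ and $\mathcal I^{\mathrm m}_{n+2}(Q)=\sum_{\mathbf c\in\mathcal P_n^{\mathrm m}}h_2(q_1,\dots,q_n)$.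
   Context: Let $\Gamma$ be a lattice of rank $d$ in $\mathbb R^d$ with basis $\mathfrak a_1,\dots,\mathfrak a_d$ and fundamental cell $\Omega=\{\sum_s x_s\mathfrak a_s: x_s\in[0,1)\}$. A $\Gamma$-periodic graph $\mathcal G=(\mathcal V,\mathcal E)$ is a connected, locally finite graph embedded in $\mathbb R^d$, invariant under translation by $\Gamma$, with finite quotient; $\mathcal G$ has no loops, multiple edges are allowed. Edges are counted with both orientations ($\mathcal A$ oriented edges, $\bar{\mathbf e}$ inverse). The fundamental graph $\mathcal G_*=(\mathcal V_*,\mathcal A_* )=\mathcal G/\Gamma$ (may contain loops and multiple edges). Every vertex is uniquely $v=v_0+[v]$ with $v_0\in\Omega$, $[v]\in\Gamma$; for $\mathbf e=(u,v)$, $\tau(\mathbf e)=[v]_{\mathbb A}-[u]_{\mathbb A}\in\mathbb Z^d$ (coordinates in the basis), defined on $\mathcal A_*$ by $\Gamma$-invariance, with $\tau(\bar{\mathbf e})=-\tau(\mathbf e)$. A potential is $Q:\mathcal V_*\to\mathbb C$. A graph is bipartite if its vertices split into two parts with every edge joining different parts. A closed path $(\mathbf e_1,\dots,\mathbf e_\ell)$, $\mathbf e_j=(v_j,v_{j+1})$, $v_{\ell+1}=v_1$, has length $\ell$; prime if not an $r$-fold repetition of a closed path with $r\ge2$. A cycle is its class under cyclic permutations (prime if the path is prime), with length $\ell$ and index $\tau(\mathbf c)=\sum_j\tau(\mathbf e_j)$. The modified fundamental graph $\widetilde{\mathcal G}_*$ is $\mathcal G_*$ with one added loop $\mathbf e_v$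 at each $v$, index $0$. Weight $\omega(\mathbf c,Q)=\prod_j\omega(\mathbf e_j)$, $\omega(\mathbf e)=1$ for $\mathbf e\in\mathcal A_*$, $\omega(\mathbf e_v)=Q(v)$. $\mathcal P,\widetilde{\mathcal P}$: prime cycles of $\mathcal G_*$, $\widetilde{\mathcal G}_*$; $\mathcal P_\ell^{\mathrm m}$: prime cycles of $\mathcal G_*$ of length $\ell$ and index $\mathrm m$. $\mathcal I_N^{\mathrm m}(Q)=\sum\frac1r\omega^r(\mathbf c,Q)$ over $r\in\{1,\dots,N\}$, $\mathbf c\in\widetilde{\mathcal P}\setminus\mathcal P$ with $r|\mathbf c|=N$, $r\tau(\mathbf c)=\mathrm m$ (a Floquet spectral invariant). *)

(* Defs.v *)
From HB Require Import structures.
From mathcomp Require Import all_boot all_order all_algebra.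
From Stdlib Require Import Relation_Operators.
Set Implicit Arguments. Unset Strict Implicit. Unset Printing Implicit Defensive.
Import Order.TTheory GRing.Theory Num.Theory.
Local Open Scope ring_scope.

Section Cycles.
Variables (V A : finType) (src tgt : A -> V).

Definition closedb (p : seq A) : bool :=
  (0 < size p)%N && all2 (fun a b => tgt a == src b) p (rot 1 p).

Definition primeb (p : seq A) : bool :=
  ~~ [exists r : 'I_(size p).+1, (1 < r)%N &&
        [exists q : ((size p) %/ r).-tuple A, p == flatten (nseq r (tval q))]].

Definition cyc_class (l : nat) (p : l.-tuple A) : {set l.-tuple A} :=
  [set rot_tuple (val i) p | i : 'I_l].

Definition pcycles (l : nat) : {set {set l.-tuple A}} :=
  [set cyc_class p | p in [pred p : l.-tuple A | closedb p && primeb p]].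

(* evaluating a (rotation invariant) quantity on a cycle via a representative *)
Definition cyc_val (T : Type) (x0 : T) (l : nat) (f : seq A -> T)
  (c : {set l.-tuple A}) : T :=
  oapp (fun p : l.-tuple A => f (tval p)) x0 [pick p in c].

Definition pidx (d : nat) (tau : A -> 'rV[int]_d) (p : seq A) : 'rV[int]_d :=
  \sum_(a <- p) tau a.
End Cycles.

(* vertices of G are pairs (v, gamma) in V_* x Z^d  (v = v_0 + [v]); an oriented
   edge e of G_* lifts to the edges (src e, g) -> (tgt e, g + tau e) of G. *)
Definition cover_adj (d : nat) (V E : Type) (src tgt : E -> V)
  (tau : E -> 'rV[int]_d) (x y : V * 'rV[int]_d) : Prop :=
  exists e, src e = x.1 /\ tgt e = y.1 /\ y.2 = x.2 + tau e.

Record fund_graph (d : nat) := FundGraph {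
  fV : finType;
  fE : finType;                      (* oriented edges A_* (both orientations) *)
  fsrc : fE -> fV;
  ftgt : fE -> fV;
  frev : fE -> fE;
  ftau : fE -> 'rV[int]_d;
  frevK : involutive frev;
  fsrc_rev : forall e, fsrc (frev e) = ftgt e;
  ftau_rev : forall e, ftau (frev e) = - ftau e;
  (* the periodic graph G has no loops *)
  fnoloop : forall e, fsrc e = ftgt e -> ftau e != 0;
  fconn : forall x y, clos_refl_trans _ (cover_adj fsrc ftgt ftau) x y
}.

Section Fund.
Variables (d : nat) (G : fund_graph d).

Definition bipartite_periodic : Prop :=
  exists col : fV G -> 'rV[int]_d -> bool,
    forall (e : fE G) (g : 'rV[int]_d),
      col (fsrc e) g != col (ftgt e) (g + ftau e).

Definition primitive (m : 'rV[int]_d) : Prop :=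
  forall k : int, (forall i, (k %| m ord0 i)%Z) -> `|k|%N = 1%N.

(* modified fundamental graph: one extra loop e_v (index 0) at each v *)
Definition mArc := (fE G + fV G)%type.
Definition msrc (a : mArc) : fV G := match a with inl e => fsrc e | inr v => v end.
Definition mtgt (a : mArc) : fV G := match a with inl e => ftgt e | inr v => v end.
Definition mtau (a : mArc) : 'rV[int]_d :=
  match a with inl e => ftau e | inr _ => 0 end.
Definition is_added (a : mArc) : bool := if a is inr _ then true else false.

Variable (C : numClosedFieldType) (Q : fV G -> C).

Definition omega (p : seq mArc) : C :=
  \prod_(a <- p) match a with inl _ => 1 | inr v => Q v end.

(* I_N^m(Q) = sum over r in {1..N}, c in P~ \ P, r|c| = N, r tau(c) = m
   of (1/r) omega(c,Q)^r.  c in P~ \ P  <=>  c uses at least one added loop. *)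
Definition Iinv (N : nat) (m : 'rV[int]_d) : C :=
  \sum_(r < N.+1 | (0 < r)%N && (r %| N)%N)
    \sum_(c in pcycles msrc mtgt (N %/ r) |
            cyc_val false (fun p => has is_added p && (pidx mtau p *+ r == m)) c)
      (r%:R)^-1 * (cyc_val 0 omega c) ^+ r.

Definition Pm (l : nat) (m : 'rV[int]_d) : {set {set l.-tuple (fE G)}} :=
  [set c in pcycles (@fsrc d G) (@ftgt d G) l |
     cyc_val false (fun p => pidx (@ftau d G) p == m) c].

Definition qs (p : seq (fE G)) : seq C := map (fun e => Q (fsrc e)) p.
End Fund.

Definition h1 (C : numClosedFieldType) (x : seq C) : C := \sum_(j < size x) x`_j.
Definition h2 (C : numClosedFieldType) (x : seq C) : C :=
  \sum_(j < size x) \sum_(l < size x | (j <= l)%N) x`_j * x`_l.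

(* Main.v *)
(** A closed path whose index [m] is primitive is prime, so its [N] rotations are
    distinct; hence [N * I_N^m(Q)] is the sum of [omega] over the closed paths of
    length [N] and index [m] through at least one added loop.  Deleting the loops
    of such a path leaves a closed path of the fundamental graph with index [m],
    so [N = n + 1] allows one loop and [N = n + 2] one or two.  Among the paths
    with [k] loops, those ending with an edge of the fundamental graph carry the
    fraction [(N - k) / N] of the total weight, and are obtained from the closed
    paths [s] of length [N - k] by inserting loops in front of the edges of [s],
    which contributes [h_k(q_1, ..., q_(N-k))].  If the periodic graph is
    bipartite then, being connected, it has its two colours either preserved or
    exchanged by translation by [m], so all closed paths of index [m] have lengths
    of the same parity. *)

Require Import Defs.
From HB Require Import structures.
From mathcomp Require Import all_boot all_order all_algebra.
From mathcomp Require Import ring zify.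
Set Implicit Arguments. Unset Strict Implicit. Unset Printing Implicit Defensive.
Import Order.TTheory GRing.Theory Num.Theory.
Local Open Scope ring_scope.

(** * Rotations fixing a sequence, and primality *)

Lemma nth_rot_mod (T : Type) (x0 : T) (k j : nat) (p : seq T) :
  (k <= size p)%N -> (j < size p)%N ->
  nth x0 (rot k p) j = nth x0 p ((j + k) %% size p).
Proof.
move=> kl jl; rewrite nth_cat size_drop nth_drop; case: ltnP => h.
  by rewrite modn_small addnC //; move: h; rewrite ltn_subRL addnC.
rewrite nth_take; last by move: kl jl h; clear; lia.
have jk : (size p <= j + k)%N by rewrite -leq_subLR in h *; move: kl h; clear; lia.
rewrite -[in RHS](subnK jk) modnDr modn_small; last by move: kl jl jk; clear; lia.
by congr (nth _ _ _); move: kl h; clear; lia.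
Qed.

(** Entries of [p] do not change when indices shift by [k] modulo [size p]. Bezout gives [t] such
    that a shift by [t * k] undoes the shift by the gcd. *)
Lemma rot_gcdn (T : Type) (k : nat) (p : seq T) :
  (k <= size p)%N -> rot k p = p -> rot (gcdn k (size p)) p = p.
Proof.
move=> kl pk; case: (posnP (size p)) => [/size0nil-> // | l0].
have [x0 _] : {x0 : T | true} by case: p l0 {kl pk} => // x ? _; exists x.
have nthtk t i : nth x0 p ((i + t * k) %% size p) = nth x0 p (i %% size p).
  elim: t => [|t IH]; first by rewrite mul0n addn0.
  by rewrite mulSnr addnA -modnDml -nth_rot_mod ?pk ?ltn_mod.
have gl : (gcdn k (size p) <= size p)%N by rewrite dvdn_leq ?dvdn_gcdr.
have [t _ tE] := Bezoutr k l0.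
apply: (@eq_from_nth _ x0); rewrite size_rot // => i il.
rewrite nth_rot_mod // -(nthtk t) -addnA -modnDmr.
have/eqP-> : ((gcdn k (size p) + t * k) %% size p == 0)%N by exact: tE.
by rewrite addn0 modn_small.
Qed.

Lemma rot_eq_flatten (T : eqType) (g r : nat) (p : seq T) :
  size p = (r * g)%N -> rot g p = p -> p = flatten (nseq r (take g p)).
Proof.
move=> pl pg.
have pig i : (i < r)%N -> rot (i * g) p = p.
  elim: i => [|i IH] ir; first by rewrite mul0n rot0.
  rewrite mulSn addnC rotD ?pg ?IH //; first exact: ltnW.
  by rewrite -mulSnr pl leq_mul2r (ltnW ir) orbT.
rewrite -[LHS](@reshapeKr _ (nseq r g)) ?sumn_nseq ?pl; last by rewrite mulnC.
congr flatten; apply: (@eq_from_nth _ [::]).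
  by rewrite size_reshape !size_nseq.
move=> i; rewrite size_reshape size_nseq => ir.
rewrite nth_reshape !nth_nseq ir take_nseq ?sumn_nseq; last by lia.
rewrite mulnC -[in RHS](pig i ir) /rot takel_cat // size_drop pl -mulnBl.
by rewrite leq_pmull // subn_gt0.
Qed.

(** If such a rotation fixed [p], then [gcdn k (size p)] would be a proper period dividing the
    length, and [p] would repeat its first block. *)
Lemma prime_rot_neq {A : finType} (k : nat) (p : seq A) :
  primeb p -> (0 < k < size p)%N -> rot k p != p.
Proof.
move=> pp /andP[k0 kl]; apply: contraNneq pp => pk.
set g := gcdn k (size p).
have g0 : (0 < g)%N by rewrite gcdn_gt0 k0.
have gk : (g <= k)%N by rewrite dvdn_leq ?dvdn_gcdl.
have pl : size p = (size p %/ g * g)%N by rewrite divnK ?dvdn_gcdr.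
have pgE := rot_gcdn (ltnW kl) pk; rewrite -/g in pgE.
have l0 : (0 < size p)%N by lia.
have rl : (size p %/ g < (size p).+1)%N by rewrite ltnS leq_div.
apply/existsP; exists (Ordinal rl) => /=; apply/andP; split; first by nia.
have st : size (take g p) == (size p %/ (size p %/ g))%N.
  rewrite size_takel; last by lia.
  have r0 : (0 < size p %/ g)%N by nia.
  by rewrite [X in (X %/ _)%N]pl mulKn.
apply/existsP; exists (Tuple st); apply/eqP => /=; exact: rot_eq_flatten.
Qed.

(** * Closed paths, their indices and their rotation classes *)

Section Cycles.
Variables (V A : finType) (src tgt : A -> V).

Lemma closedb_cycle (p : seq A) :
  closedb src tgt p = (0 < size p)%N && cycle (fun a b => tgt a == src b) p.
Proof.
case: p => // a p; rewrite /closedb rot1_cons /=.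
suff E b : all2 (fun a b => tgt a == src b) (a :: p) (rcons p b)
           = path (fun a b => tgt a == src b) a (rcons p b) by apply: E.
by elim: p a => //= c p IH a; rewrite -IH.
Qed.

Lemma closedb_rot (i : nat) (p : seq A) :
  closedb src tgt (rot i p) = closedb src tgt p.
Proof. by rewrite !closedb_cycle size_rot rot_cycle. Qed.

Lemma pidx_rot (d : nat) (tau : A -> 'rV[int]_d) (i : nat) (p : seq A) :
  pidx tau (rot i p) = pidx tau p.
Proof. by apply: perm_big; rewrite perm_rot. Qed.

Lemma primitive_pidxMn (d : nat) (tau : A -> 'rV[int]_d) (r : nat) (m : 'rV[int]_d)
  (p : seq A) : primitive m -> pidx tau p *+ r = m -> r = 1%N.
Proof.
move=> hm e; have := hm r; apply => i.
by rewrite -e mulmxnE -mulr_natr natz dvdz_mull.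
Qed.

Lemma primitive_pidx_prime (d : nat) (tau : A -> 'rV[int]_d) (m : 'rV[int]_d)
  (p : seq A) : primitive m -> pidx tau p = m -> primeb p.
Proof.
move=> hm e; apply/existsP => -[r /andP[r1 /existsP[q /eqP pq]]].
have E k s : pidx tau (flatten (nseq k s)) = pidx tau s *+ k.
  by rewrite /pidx big_flatten /= big_nseq -GRing.iter_addr_0.
have : pidx tau q *+ r = m by rewrite -e -E; apply: congr1.
by move/(primitive_pidxMn hm) => r1'; rewrite r1' in r1.
Qed.

Lemma cyc_classP (l : nat) (p q : l.-tuple A) :
  reflect (exists2 i, (i < l)%N & q = rot i p :> seq A) (q \in cyc_class p).
Proof.
apply: (iffP imsetP) => [[i _ ->]|[i il e]]; first by exists i.
by exists (Ordinal il) => //; apply: val_inj.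
Qed.

Lemma cyc_class_rot (l i : nat) (p q : l.-tuple A) :
  (0 < l)%N -> q = rot i p :> seq A -> q \in cyc_class p.
Proof.
move=> l0 e; apply/cyc_classP; have [il|li] := ltnP i l; first by exists i.
by exists 0%N => //; rewrite rot0 e rot_oversize ?size_tuple.
Qed.

Lemma cyc_class_sub (l : nat) (p q : l.-tuple A) :
  q \in cyc_class p -> cyc_class q \subset cyc_class p.
Proof.
case/cyc_classP => i il e; apply/subsetP => s /cyc_classP[j jl].
rewrite e rot_add_mod ?size_tuple; try exact: ltnW.
by apply: cyc_class_rot; case: (l) il.
Qed.

Lemma cyc_class_sym (l : nat) (p q : l.-tuple A) :
  q \in cyc_class p -> p \in cyc_class q.
Proof.
case/cyc_classP => i il e; apply: (@cyc_class_rot _ (l - i)); first by case: (l) il.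
by rewrite e -{1}(rotK i p) /rotr size_rot size_tuple.
Qed.

Lemma cyc_class_eq (l : nat) (p q : l.-tuple A) : (0 < l)%N ->
  (cyc_class q == cyc_class p) = (q \in cyc_class p).
Proof.
move=> l0; apply/eqP/idP => [<-|qp].
  by apply: (@cyc_class_rot _ 0); rewrite ?rot0.
by apply/eqP; rewrite eqEsubset !cyc_class_sub // cyc_class_sym.
Qed.

(** If the rotations by [i < j] agreed, the rotation by [j - i] would fix [p], against primality. *)
Lemma card_cyc_class (l : nat) (p : l.-tuple A) : primeb p -> #|cyc_class p| = l.
Proof.
move=> pp; rewrite card_imset ?card_ord //.
have H (i j : 'I_l) : (i < j)%N -> rot_tuple i p != rot_tuple j p.
  move=> ij; apply: contraTneq pp => /(congr1 val) /= e.
  have jl := ltn_ord j.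
  apply/negP => pp; have : (0 < j - i < size p)%N by rewrite size_tuple; lia.
  move/(prime_rot_neq pp)/eqP; apply; apply: (@rot_inj i).
  by rewrite e -rotD ?subnKC ?size_tuple //; lia.
move=> i j /= /eqP e; apply: val_inj; case: (ltngtP i j) => // /H.
  by rewrite e.
by rewrite eq_sym e.
Qed.

Lemma cyc_val_class (T : Type) (x0 : T) (l : nat) (f : seq A -> T) (p : l.-tuple A) :
  (0 < l)%N -> (forall i s, f (rot i s) = f s) -> cyc_val x0 f (cyc_class p) = f p.
Proof.
move=> l0 fr; rewrite /cyc_val; case: pickP => [q|/(_ p)].
  by case/cyc_classP => i _ /= ->.
by rewrite (@cyc_class_rot _ 0) // rot0.
Qed.

(** Group the paths by cycle: [P] forces primality, so each class consists of exactly [l] paths, and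
    [f] is constant on it. *)
Lemma sum_pcycles (R : pzSemiRingType) (l : nat) (P : pred (seq A)) (f : seq A -> R) :
  (forall i s, P (rot i s) = P s) -> (forall i s, f (rot i s) = f s) ->
  (forall s, P s -> primeb s) ->
  \sum_(p : l.-tuple A | closedb src tgt p && P p) f p
  = l%:R * \sum_(c in pcycles src tgt l | cyc_val false P c) cyc_val 0 f c.
Proof.
move=> Pr fr Pp.
have closed0 (p : l.-tuple A) : closedb src tgt p -> (0 < l)%N.
  by case/andP; rewrite size_tuple.
rewrite (partition_big (@cyc_class A l)
  (fun c => (c \in pcycles src tgt l) && cyc_val false P c)) /=; last first.
  move=> p /andP[cp Ppp]; rewrite cyc_val_class ?(closed0 p) // Ppp andbT.
  by apply/imsetP; exists p => //; rewrite inE cp Pp.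
rewrite mulr_sumr; apply: eq_bigr => c /andP[/imsetP[p]].
rewrite inE => /andP[cp pp] -> {c}; have l0 := closed0 _ cp.
rewrite !cyc_val_class // => Ppp.
rewrite (eq_bigl (mem (cyc_class p))) => [|q]; last first.
  rewrite cyc_class_eq //= andbC; case: cyc_classP => //= -[i _ ->].
  by rewrite closedb_rot Pr cp Ppp.
rewrite (eq_bigr (fun=> f p)) => [|q /cyc_classP[i _ ->]]; last by rewrite fr.
by rewrite sumr_const card_cyc_class // mulr_natl.
Qed.

(* [head_src p v] is where [p] starts when its end point is [v], so that
   [chain p v] says that [p] is a walk ending at [v]. *)
Definition head_src (p : seq A) (v : V) : V := if p is a :: _ then src a else v.

Fixpoint chain (p : seq A) (v : V) : bool :=
  if p is a :: q then (tgt a == head_src q v) && chain q v else true.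

(** A closed path is a walk ending at its own start. The default [v] matters only for the empty
    path, which both sides reject. *)
Lemma closedb_chain (p : seq A) (v : V) :
  closedb src tgt p = (0 < size p)%N && chain p (head_src p v).
Proof.
rewrite closedb_cycle; case: p => // a p /=.
suff E b : path (fun a b => tgt a == src b) a (rcons p b)
           = (tgt a == head_src p (src b)) && chain p (src b) by apply: E.
by elim: p a => [|c p IH] a /=; rewrite ?IH ?andbT.
Qed.
End Cycles.

(** * Sums over tuples: splitting off the first entry, averaging over rotations *)

Lemma sum_tupleS (R : nmodType) (T : finType) (N : nat) (F : seq T -> R) :
  \sum_(w : N.+1.-tuple T) F w = \sum_(a : T) \sum_(w : N.-tuple T) F (a :: w).
Proof.
rewrite pair_big /=.
rewrite (reindex (fun p : T * N.-tuple T => cons_tuple p.1 p.2)) //=.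
exists (fun w => (thead w, behead_tuple w)) => [[a w] _|w _] /=.
  by congr pair; apply: val_inj.
by rewrite [RHS]tuple_eta; apply: val_inj.
Qed.

(** Double counting of paths with a marked position where [b] holds: each path has [k] of them, and
    by rotation each of the [l] positions gives the same total as the last. *)
Lemma sum_last_rot (R : pzSemiRingType) (A : finType) (l k : nat) (P : pred (seq A))
  (f : seq A -> R) (b : pred A) (x0 : bool) :
  (forall i s, P (rot i s) = P s) -> (forall i s, f (rot i s) = f s) ->
  (forall s : l.-tuple A, P s -> count b s = k) ->
  l%:R * \sum_(p : l.-tuple A | P p && last x0 (map b p)) f p
  = k%:R * \sum_(p : l.-tuple A | P p) f p.
Proof.
move=> Pr fr Pk; set S := \sum_(p | _ && last _ _) _.
have -> : l%:R * S = \sum_(j < l) S by rewrite sumr_const card_ord mulr_natl.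
transitivity (\sum_(j < l) \sum_(p : l.-tuple A | P p && nth x0 (map b p) j) f p).
  apply: eq_bigr => j _; have jl := ltn_ord j; rewrite /S.
  (* Rotating by [l - j.+1] brings the last entry to position [j]. *)
  rewrite [RHS](reindex_inj (h := fun p : l.-tuple A => rot_tuple (l - j.+1) p)) /=.
    apply: eq_big => [p|p _]; rewrite ?fr // Pr; congr (_ && _).
    rewrite map_rot -nth_last nth_rot_mod ?size_map ?size_tuple ?leq_subr //.
    have -> : (j + (l - j.+1) = l.-1)%N by lia.
    by rewrite modn_small //; lia.
  by move=> p q /(congr1 val) /= /rot_inj/val_inj.
rewrite (exchange_big_dep (fun p : l.-tuple A => P p)) /=; last by move=> ? ? _ /andP[].
rewrite mulr_sumr; apply: eq_bigr => p Pp.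
rewrite (eq_bigl (fun j : 'I_l => nth x0 (map b p) j)) => [|j]; last by rewrite Pp.
have cE (s : seq bool) : (\sum_(j < size s | nth x0 s j) 1 = count id s)%N.
  by rewrite -sum1_count (big_nth x0) big_mkord.
have := cE (map b p); rewrite size_map size_tuple count_map Pk // => <-.
by rewrite sumr_const sum1_card mulr_natl.
Qed.

(** * Deleting and inserting added loops *)

Section Modified.
Variables (d : nat) (G : fund_graph d).

Definition strip (w : seq (mArc G)) : seq (fE G) :=
  pmap (fun a => if a is inl e then Some e else None) w.

Lemma pidx_strip (w : seq (mArc G)) :
  pidx (@mtau d G) w = pidx (@ftau d G) (strip w).
Proof.
rewrite /pidx; elim: w => [|[e|v] w IH]; rewrite ?big_nil //= !big_cons IH //.
by rewrite add0r.
Qed.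

Lemma size_strip (w : seq (mArc G)) :
  size (strip w) = count (predC (@is_added d G)) w.
Proof. by elim: w => [|[e|v] w IH] //=; rewrite IH. Qed.

Lemma size_strip_added (w : seq (mArc G)) :
  (count (@is_added d G) w + size (strip w))%N = size w.
Proof. by rewrite size_strip count_predC. Qed.

Local Notation fhead := (head_src (@fsrc d G)).
Local Notation mhead := (head_src (@msrc d G)).
Local Notation fchain := (chain (@fsrc d G) (@ftgt d G)).
Local Notation mchain := (chain (@msrc d G) (@mtgt d G)).
Local Notation fclosed := (closedb (@fsrc d G) (@ftgt d G)).
Local Notation mclosed := (closedb (@msrc d G) (@mtgt d G)).

Lemma chain_strip (w : seq (mArc G)) (v : fV G) :
  mchain w v -> fchain (strip w) v /\ fhead (strip w) v = mhead w v.
Proof.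
elim: w => [|[e|u] w IH] //= /andP[/eqP e1 /IH[c h]].
  by rewrite h e1 eqxx.
by rewrite h e1.
Qed.

(** A loop has equal ends, so deleting it breaks no junction. Nonemptiness excludes paths made of
    loops only. *)
Lemma closedb_strip (w : seq (mArc G)) :
  mclosed w -> strip w != [::] -> fclosed (strip w).
Proof.
case: w => // a w; rewrite (closedb_chain _ _ _ (msrc a)) => /andP[_ c] s0.
have [c' h] := chain_strip c; rewrite (closedb_chain _ _ _ (msrc a)).
by rewrite lt0n size_eq0 s0 /=; move: c'; rewrite -[head_src _ (a :: w) _]h.
Qed.

(* [anchored w]: every added loop is followed by an arc at the same vertex, so
   [w] is determined by the multiplicities of the loops preceding each edge of
   [strip w]. *)
Fixpoint anchored (w : seq (mArc G)) : bool :=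
  if w is a :: w' then
    (if a is inr v then (if w' is b :: _ then v == msrc b else false) else true)
    && anchored w'
  else true.

Lemma head_anchored (w : seq (mArc G)) (v : fV G) :
  anchored w -> fhead (strip w) v = mhead w v.
Proof.
elim: w => [|[e|u] w IH] //= /andP[]; case: w IH => // b w IH /eqP-> /IH.
by [].
Qed.

(** In a nonempty path of loops only, the last loop has no arc after it. *)
Lemma anchored_strip_nil (w : seq (mArc G)) : anchored w -> strip w = [::] -> w = [::].
Proof.
elim: w => [|[e|u] w IH] //= /andP[h /IH{}IH] /IH w0.
by rewrite w0 in h.
Qed.

(** The default [true] lets the empty walk, which is anchored, start the induction below. *)
Definition ends_real (w : seq (mArc G)) : bool :=
  last true (map (predC (@is_added d G)) w).

(** The junction after a loop is exactly the anchoring condition, except for a final loop, which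
    [ends_real] excludes. Junctions after edges can then be read off [strip w]. *)
Lemma chain_anchored (w : seq (mArc G)) (v : fV G) :
  mchain w v && ends_real w = anchored w && fchain (strip w) v.
Proof.
elim: w => // a w; case: w => [|b w].
  by case: a => [e|u]; rewrite /ends_real /= ?andbF ?andbT.
rewrite [ends_real _]/(ends_real (b :: w)) => IH.
case: a => [e|u].
  rewrite [mchain _ _]/((ftgt e == mhead (b :: w) v) && mchain (b :: w) v).
  have aE : anchored (inl e :: b :: w) = anchored (b :: w) by [].
  rewrite -andbA IH aE.
  case: (boolP (anchored (b :: w))) => [|_]; last by rewrite andbF.
  by move/(head_anchored v) => /= ->.
rewrite [mchain _ _]/((u == mhead (b :: w) v) && mchain (b :: w) v).
by rewrite -andbA IH andbA.
Qed.

Lemma closedb_anchored (w : seq (mArc G)) :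
  mclosed w && ends_real w = anchored w && fclosed (strip w).
Proof.
case: w => // a w; rewrite !(closedb_chain _ _ _ (msrc a)).
have cE : (0 < size (a :: w))%N && mchain (a :: w) (mhead (a :: w) (msrc a))
  = mchain (a :: w) (msrc a) by [].
rewrite cE chain_anchored.
case: (boolP (anchored (a :: w))) => // h; rewrite (head_anchored _ h).
by rewrite lt0n size_eq0; case: eqP => // /(anchored_strip_nil h).
Qed.

Variables (C : numClosedFieldType) (Q : fV G -> C).

(* The complete homogeneous symmetric polynomial of degree [N - size x]
   ([0] if [N < size x]). *)
Fixpoint hsum (N : nat) (x : seq C) : C :=
  match N, x with
  | 0, [::] => 1
  | N'.+1, y :: x' => hsum N' x' + y * hsum N' x
  | _, _ => 0
  end.

(** The recursion of [hsum] splits by the first arc: either the first edge of [s], or a loop at its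
    source, which contributes the factor [Q] and leaves [s] intact. *)
Lemma sum_anchored (N : nat) (s : seq (fE G)) :
  \sum_(w : N.-tuple (mArc G) | anchored w && (strip w == s)) omega Q w
  = hsum N (qs Q s).
Proof.
elim: N s => [|N IH] s.
  case: s => [|e s].
    rewrite (big_pred1 [tuple]) => [|w]; last by rewrite (tuple0 w) [RHS]eqxx.
    by rewrite /omega big_nil.
  by rewrite big_pred0 // => w; rewrite (tuple0 w).
rewrite big_mkcond /= (sum_tupleS _
  (fun w => if anchored w && (strip w == s) then omega Q w else 0)).
rewrite big_sumType /=.
case: s => [|e s] /=.
  rewrite !big1 ?addr0 // => [v|e] _; rewrite big1 // => w _.
    case: ifP => // /andP[/andP[h a] /eqP /(anchored_strip_nil a) w0].
    by rewrite w0 in h.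
  by rewrite andbF.
congr (_ + _).
  rewrite -IH (bigD1 e) //= [X in _ + X]big1 ?addr0 => [|e' e'e]; last first.
    by rewrite big1 // => w _; rewrite eqseq_cons (negbTE e'e) andbF.
  rewrite [RHS]big_mkcond /=; apply: eq_bigr => w _.
  by rewrite eqseq_cons eqxx /= /omega big_cons mul1r.
(* Anchoring forces the leading loop to sit at [fsrc e]. *)
rewrite -(IH (e :: s)) (bigD1 (fsrc e)) //= [X in _ + X]big1 ?addr0 => [|v ve].
  rewrite mulr_sumr [RHS]big_mkcond /=; apply: eq_bigr => w _.
  case: (boolP (anchored w)) => a; last by rewrite andbF.
  case: eqP => se; last by rewrite andbF.
  have := head_anchored (fsrc e) a; rewrite se /=.
  case: (tval w) se => [|b w'] //= _ <-.
  by rewrite eqxx /= /omega big_cons.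
rewrite big1 // => w _; case: ifP => // /andP[/andP[h a] /eqP se].
have := head_anchored v a; rewrite se /=.
case: (tval w) h => [|b w'] //= /eqP <- /eqP.
by rewrite eq_sym (negbTE ve).
Qed.
End Modified.

(** * Symmetry of [h1] and [h2], and their agreement with [hsum] *)

Section Homogeneous.
Variable C : numClosedFieldType.
Implicit Type x : seq C.

Lemma h1E x : h1 x = \sum_(y <- x) y.
Proof. by rewrite (big_nth 0) big_mkord. Qed.

Lemma h1_cons y x : h1 (y :: x) = y + h1 x.
Proof. by rewrite !h1E big_cons. Qed.

Lemma h2_cons y x : h2 (y :: x) = y * h1 (y :: x) + h2 x.
Proof.
rewrite /h2 big_ord_recl /=; congr (_ + _); first by rewrite mulr_sumr.
apply: eq_bigr => j _; rewrite big_mkcond big_ord_recl /= add0r -big_mkcond /=.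
by apply: eq_bigl => l.
Qed.

(** Power sums make visible the symmetry that the ordered index pairs in [h2] hide; the factor 2
    cancels in characteristic 0. *)
Lemma h2E x : h2 x *+ 2 = (\sum_(y <- x) y) ^+ 2 + \sum_(y <- x) y ^+ 2.
Proof.
elim: x => [|y x IH]; first by rewrite /h2 big_ord0 !big_nil; ring.
rewrite h2_cons mulrnDl IH h1_cons h1E !big_cons; ring.
Qed.

Lemma h1_perm x y : perm_eq x y -> h1 x = h1 y.
Proof. by move=> xy; rewrite !h1E; apply: perm_big. Qed.

Lemma h2_perm x y : perm_eq x y -> h2 x = h2 y.
Proof.
by move=> xy; apply: (@pmulrnI C 2) => //; rewrite !h2E !(perm_big _ xy).
Qed.

Lemma hsum_lt (N : nat) x : (N < size x)%N -> hsum N x = 0.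
Proof.
elim: N x => [|N IH] [|y x] //= Nx.
by rewrite !IH ?mulr0 ?addr0 //= ltnW.
Qed.

Lemma hsum0 x : hsum (size x) x = 1.
Proof. by elim: x => //= y x ->; rewrite hsum_lt ?mulr0 ?addr0 /=. Qed.

Lemma hsum1 x : hsum (size x).+1 x = h1 x.
Proof.
elim: x => [|y x IH]; first by rewrite h1E big_nil.
rewrite h1_cons [LHS]/(hsum (size x).+1 x + y * hsum (size (y :: x)) (y :: x)).
by rewrite IH hsum0 mulr1 addrC.
Qed.

(** Both sides satisfy [h_2(y, x) = h_2(x) + y * h_1(y, x)]. *)
Lemma hsum2 x : hsum (size x).+2 x = h2 x.
Proof.
elim: x => [|y x IH]; first by rewrite /h2 big_ord0.
rewrite h2_cons [LHS]/(hsum (size x).+2 x + y * hsum (size (y :: x)).+1 (y :: x)).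
by rewrite IH hsum1 addrC.
Qed.
End Homogeneous.

(** * Spectral invariants as sums over closed paths of primitive index *)

Lemma primitive_neq0 (d : nat) (m : 'rV[int]_d) : primitive m -> m != 0.
Proof.
move=> hm; apply/eqP => m0; suff : `|2%:Z|%N = 1%N by [].
by apply: hm => i; rewrite m0 mxE dvdz0.
Qed.

Section Invariants.
Variables (d : nat) (G : fund_graph d) (C : numClosedFieldType) (Q : fV G -> C).
Variables (m : 'rV[int]_d) (hm : primitive m).

Local Notation fclosed := (closedb (@fsrc d G) (@ftgt d G)).
Local Notation mclosed := (closedb (@msrc d G) (@mtgt d G)).
Local Notation fidx := (pidx (@ftau d G)).
Local Notation midx := (pidx (@mtau d G)).
Local Notation added := (@is_added d G).

Lemma omega_rot (i : nat) (w : seq (mArc G)) : omega Q (rot i w) = omega Q w.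
Proof. by apply: perm_big; rewrite perm_rot. Qed.

Lemma count_rot (T : Type) (a : pred T) (i : nat) (s : seq T) :
  count a (rot i s) = count a s.
Proof. by rewrite /rot count_cat addnC -count_cat cat_take_drop. Qed.

Lemma Iinv_paths (N : nat) : (0 < N)%N ->
  N%:R * Iinv Q N m
  = \sum_(w : N.-tuple (mArc G) | mclosed w && (has added w && (midx w == m)))
      omega Q w.
Proof.
move=> N0; rewrite /Iinv.
have lt1 : (1 < N.+1)%N by [].
(* Any contributing [r] divides all coordinates of [m], so only [r = 1] survives. *)
rewrite (bigD1 (Ordinal lt1)) //= [X in _ + X]big1 ?addr0 => [|r /andP[_ r1]]; last first.
  rewrite big1 // => c /andP[_]; rewrite /cyc_val; case: pickP => //= p _.
  case/andP => _ /eqP/(primitive_pidxMn hm) r1'.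
  by case/eqP: r1; apply: val_inj.
rewrite divn1; under eq_bigr do rewrite invr1 mul1r expr1.
rewrite (@sum_pcycles _ _ _ _ _ _ (fun w => has added w && (midx w == m)) (omega Q)).
- by congr (_ * _); apply: eq_bigl => c; rewrite /cyc_val; case: pickP.
- by move=> i s; rewrite !has_count count_rot pidx_rot.
- exact: omega_rot.
- by move=> s /andP[_ /eqP]; apply: primitive_pidx_prime hm.
Qed.

Definition loop_paths (k : nat) : pred (seq (mArc G)) :=
  fun w => [&& mclosed w, midx w == m & count added w == k].

(** Group the paths by [strip w]: those ending with an edge are the anchored ones, and having [k]
    loops among [N] arcs means that [l] edges remain. *)
Lemma sum_loop_paths_real (N k l : nat) : N = (k + l)%N ->
  \sum_(w : N.-tuple (mArc G) | loop_paths k w && ends_real w) omega Q w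
  = \sum_(s : l.-tuple (fE G) | fclosed s && (fidx s == m)) hsum N (qs Q s).
Proof.
move=> Nkl; under [RHS]eq_bigr do rewrite -sum_anchored.
rewrite (exchange_big_dep (fun w : N.-tuple (mArc G) =>
  loop_paths k w && ends_real w)) /=; last first.
  move=> s w /andP[cs /eqP si] /andP[aw /eqP ws].
  have := closedb_anchored w; rewrite aw ws cs => /andP[cw ew].
  rewrite /loop_paths cw ew pidx_strip ws si eqxx andbT /=.
  by have := size_strip_added w; rewrite ws !size_tuple [in RHS]Nkl => /addIn ->.
apply: eq_bigr => w /andP[/and3P[cw /eqP wi /eqP wk] ew].
have sw : size (strip w) == l.
  have := size_strip_added w; rewrite wk size_tuple [in RHS]Nkl => /addnI ->; exact: eqxx.
have := closedb_anchored w; rewrite cw ew => /esym/andP[aw cs].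
rewrite (big_pred1 (Tuple sw)) // => s /=; rewrite aw /= [RHS]eq_sym -[RHS]val_eqE /=.
case: (strip w =P tval s) => [<-|_]; last by rewrite andbF.
by rewrite cs -pidx_strip wi eqxx.
Qed.

Lemma sum_Pm (l : nat) (f : seq (fE G) -> C) : (forall i s, f (rot i s) = f s) ->
  \sum_(s : l.-tuple (fE G) | fclosed s && (fidx s == m)) f s
  = l%:R * \sum_(c in Pm G l m) cyc_val 0 f c.
Proof.
move=> fr; rewrite (@sum_pcycles _ _ _ _ _ _ (fun s => fidx s == m) f) //.
- by congr (_ * _); apply: eq_bigl => c; rewrite inE.
- by move=> i s; rewrite pidx_rot.
- by move=> s /eqP; apply: primitive_pidx_prime hm.
Qed.

(** Paths ending with an edge carry the fraction [l / N] of the total, while the sum over closed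
    paths of length [l] counts each cycle [l] times; the factor [l] cancels. *)
Lemma sum_loop_paths (N k l : nat) (f : seq (fE G) -> C) : N = (k + l)%N -> (0 < l)%N ->
  (forall i s, f (rot i s) = f s) ->
  (forall s : l.-tuple (fE G), hsum N (qs Q s) = f s) ->
  \sum_(w : N.-tuple (mArc G) | loop_paths k w) omega Q w
  = N%:R * \sum_(c in Pm G l m) cyc_val 0 f c.
Proof.
move=> Nkl l0 fr hf; have l0' : l%:R != 0 :> C by rewrite pnatr_eq0 -lt0n.
apply: (mulfI l0'); rewrite mulrCA -sum_Pm //.
under [X in _ = _ * X]eq_bigr do rewrite -hf.
rewrite -(sum_loop_paths_real (k := k)) //; symmetry; apply: sum_last_rot.
- by move=> i s; rewrite /loop_paths closedb_rot pidx_rot count_rot.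
- exact: omega_rot.
- move=> s /and3P[_ _ /eqP ck]; have := size_strip_added s.
  by rewrite ck size_strip size_tuple [in RHS]Nkl => /addnI.
Qed.

(** As [m] is nonzero, [strip w] is nonempty, hence a closed path of index [m] with at least [n]
    edges. *)
Lemma loop_paths_bound (n : nat) (w : seq (mArc G)) :
  (forall (k : nat) (p : k.-tuple (fE G)), fclosed p -> fidx p = m -> (n <= k)%N) ->
  mclosed w -> midx w = m -> (count added w + n <= size w)%N.
Proof.
move=> hmin cw wi; rewrite -[X in (_ <= X)%N](size_strip_added w) leq_add2l.
apply: (hmin _ (in_tuple (strip w))) => /=; last by rewrite -pidx_strip.
apply: closedb_strip => //; apply: contra (primitive_neq0 hm) => /eqP s0.
by rewrite -wi pidx_strip s0 /pidx big_nil.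
Qed.
End Invariants.

(** * Parity of closed paths when the periodic graph is bipartite *)

Section Bipartite.
Variables (d : nat) (G : fund_graph d) (col : fV G -> 'rV[int]_d -> bool).
Hypothesis hcol : forall (e : fE G) g, col (fsrc e) g != col (ftgt e) (g + ftau e).

Lemma col_chain (p : seq (fE G)) (v : fV G) (g : 'rV[int]_d) :
  chain (@fsrc d G) (@ftgt d G) p v ->
  col (head_src (@fsrc d G) p v) g (+) col v (g + pidx (@ftau d G) p) = odd (size p).
Proof.
rewrite /pidx; elim: p g => [|e p IH] g /=; first by rewrite big_nil addr0 addbb.
case/andP => /eqP h /(IH (g + ftau e)); rewrite big_cons addrA => <-.
by rewrite -h; have := hcol e g; do 3!case: col.
Qed.

(** Along an edge of the periodic graph both colours flip, so their sum stays constant;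
    connectedness does the rest. *)
Lemma col_shift (m : 'rV[int]_d) (x y : fV G * 'rV[int]_d) :
  col x.1 x.2 (+) col x.1 (x.2 + m) = col y.1 y.2 (+) col y.1 (y.2 + m).
Proof.
elim: (fconn x y) => {x y} [x y|x //|x y z _ -> _ //].
case=> e [<- [<- ->]]; have := hcol e x.2; have := hcol e (x.2 + m).
by rewrite addrAC; do 4!case: col.
Qed.

(** A closed path lifts to a walk from a vertex to its translate by the index, and whether that
    translation swaps the colours does not depend on the vertex. *)
Lemma col_closed_parity (p q : seq (fE G)) :
  closedb (@fsrc d G) (@ftgt d G) p -> closedb (@fsrc d G) (@ftgt d G) q ->
  pidx (@ftau d G) p = pidx (@ftau d G) q -> odd (size p) = odd (size q).
Proof.
case: p q => [|a p] [|b q] // cp cq pq.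
move: cp cq; rewrite (closedb_chain _ _ _ (fsrc a)).
rewrite [in X in _ -> X -> _](closedb_chain _ _ _ (fsrc b)).
move=> /andP[_ /(col_chain 0) <-] /andP[_ /(col_chain 0) <-]; rewrite -pq.
exact: (col_shift _ (fsrc a, 0) (fsrc b, 0)).
Qed.
End Bipartite.

Theorem theorem2p11 (d : nat) (G : fund_graph d) (C : numClosedFieldType)
  (Q : fV G -> C) (m : 'rV[int]_d) (n : nat)
  (hm : primitive m)
  (hex : exists p : n.-tuple (fE G),
           closedb (@fsrc d G) (@ftgt d G) p && (pidx (@ftau d G) p == m))
  (hmin : forall (k : nat) (p : k.-tuple (fE G)),
           closedb (@fsrc d G) (@ftgt d G) p -> pidx (@ftau d G) p = m -> (n <= k)%N) :
  Iinv Q n.+1 m = \sum_(c in Pm G n m) cyc_val 0 (fun p => h1 (qs Q p)) c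
  /\ Iinv Q n.+2 m = \sum_(c in Pm G n m) cyc_val 0 (fun p => h2 (qs Q p)) c
                   + \sum_(c in Pm G n.+1 m) cyc_val 0 (fun p => h1 (qs Q p)) c
  /\ (bipartite_periodic G ->
        Pm G n.+1 m = set0 /\
        Iinv Q n.+2 m = \sum_(c in Pm G n m) cyc_val 0 (fun p => h2 (qs Q p)) c).
Proof.
case: hex => p0 /andP[cp0 /eqP ip0].
have n0 : (0 < n)%N by case/andP: cp0; rewrite size_tuple.
have h1r i s : h1 (qs Q (rot i s)) = h1 (qs Q s).
  by apply: h1_perm; rewrite /qs map_rot perm_rot.
have h2r i s : h2 (qs Q (rot i s)) = h2 (qs Q s).
  by apply: h2_perm; rewrite /qs map_rot perm_rot.
have hs1 l (s : l.-tuple (fE G)) : hsum l.+1 (qs Q s) = h1 (qs Q s).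
  by rewrite -hsum1 size_map size_tuple.
have hs2 l (s : l.-tuple (fE G)) : hsum l.+2 (qs Q s) = h2 (qs Q s).
  by rewrite -hsum2 size_map size_tuple.
have E1 : Iinv Q n.+1 m = \sum_(c in Pm G n m) cyc_val 0 (fun p => h1 (qs Q p)) c.
  have nz : n.+1%:R != 0 :> C by rewrite pnatr_eq0.
  apply: (mulfI nz); rewrite Iinv_paths //.
  rewrite -(@sum_loop_paths _ _ _ Q _ hm _ 1) //.
  (* At least [n] of the [n + 1] arcs are edges, so there is exactly one loop. *)
  apply: eq_bigl => w; rewrite /loop_paths andbCA andbC -andbA.
  case: (boolP (closedb _ _ _)) => //= cw; case: eqP => //= wi.
  have := loop_paths_bound hm hmin cw wi.
  by rewrite has_count size_tuple; lia.
have E2 : Iinv Q n.+2 m = \sum_(c in Pm G n m) cyc_val 0 (fun p => h2 (qs Q p)) c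
                   + \sum_(c in Pm G n.+1 m) cyc_val 0 (fun p => h1 (qs Q p)) c.
  have nz : n.+2%:R != 0 :> C by rewrite pnatr_eq0.
  apply: (mulfI nz); rewrite Iinv_paths // mulrDr.
  rewrite -(@sum_loop_paths _ _ _ Q _ hm _ 2) //.
  rewrite -(@sum_loop_paths _ _ _ Q _ hm _ 1) //.
  (* Two loops leave [n] edges and one loop leaves [n + 1]; the bound excludes more. *)
  rewrite (bigID (fun w : n.+2.-tuple (mArc G) => count (@is_added d G) w == 2)) /=.
  congr (_ + _); apply: eq_bigl => w; rewrite /loop_paths;
    case: (boolP (closedb _ _ _)) => //= cw; case: eqP => //= wi;
    rewrite ?andbF //; have := loop_paths_bound hm hmin cw wi;
    rewrite has_count size_tuple; lia.
split=> //; split=> // -[col hcol].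
have P0 : Pm G n.+1 m = set0.
  (* A closed path of length [n + 1] and index [m] would have the parity of [p0], whose length is
     [n]. *)
  apply/setP => c; rewrite !inE; apply/negbTE/negP => /andP[/imsetP[p]].
  rewrite inE => /andP[cp _] ->; rewrite cyc_val_class // => [/eqP ip|i s].
    have := col_closed_parity hcol cp cp0; rewrite ip ip0 => /(_ erefl).
    by rewrite !size_tuple /=; case: odd.
  by rewrite pidx_rot.
by split=> //; rewrite E2 P0 big_set0 addr0.
Qed.
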